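(* Let $\mathcal A$ be an almost disjoint family on an infinite countable set. If $\mathcal A$ is semi-proximal, then $\mathcal A$ is anti-Luzin.
   Context: An almost disjoint family on an infinite countable set $N$ is a collection $\mathcal A$ of infinite subsets of $N$ any two distinct members of which have finite intersection. Its $\Psi$-space $\Psi(\mathcal A)$ is the (disjoint) union $N\cup\mathcal A$, topologized so that $N$ is open and discrete and, for $a\in\mathcal A$, the sets $\{a\}\cup (a\setminus F)$, $F\subseteq N$ finite, form a local basis at $a$. $\mathcal A$ is anti-Luzin if for every pair of uncountable subsets $\mathcal A_0,\mathcal A_1\subseteq\mathcal A$ there exist uncountable sets $\mathcal B_0\subseteq\mathcal A_0$ and $\mathcal B_1\subseteq\mathcal A_1$ which can be separated by open sets, i.e. there are disjoint open sets $G_0,G_1\subseteq\Psi(\mathcal A)$ with $\mathcal B_0\subseteq G_0$ and $\mathcal B_1\subseteq G_1$. Proximal game on a uniform space $(Z,\mathbb U)$: for an entourage $U$ write $U[x]=\{y\in Z : (x,y)\in U\}$. At inning $0$ Player I plays $U_0\in\mathbb U$ and Player II plays $x_0\in Z$; at inning $n+1$ Player I plays $U_{n+1}\in\mathbb U$ with $U_{n+1}\subseteq U_n$ and Player II plays $x_{n+1}\in U_n[x_n]$. Player I wins if $(x_n)_{n\in\omega}$ converges in the topology induced by $\mathbb U$ or $\bigcap_{n\in\omega}U_n[x_n]=\emptyset$; otherwise Player II wins. $(Z,\mathbb U)$ is semi-proximal if Player II has no winning strategy. A strategy for Player II assigns a legal move to each finite sequence of moves of Player I; it is winning if Player II wins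 every run following it. A topological space is semi-proximal if there is a uniformity $\mathbb U$ inducing its topology for which the uniform space is semi-proximal. An almost disjoint family is called semi-proximal if its $\Psi$-space is. *)

(* Defs.v *)
From HB Require Import structures.
From mathcomp Require Import all_boot all_classical topology.

Set Implicit Arguments.
Unset Strict Implicit.
Unset Printing Implicit Defensive.

Local Open Scope classical_set_scope.

Definition almost_disjoint (N : Type) (A : set (set N)) : Prop :=
  (forall a, A a -> infinite_set a) /\
  (forall a b, A a -> A b -> a <> b -> finite_set (a `&` b)).

(* [A] in the sum is the subtype of [set N] determined by [A]. *)
Definition Psi (N : choiceType) (A : set (set N)) : Type := (N + A)%type.

Section PsiSpace.
Context (N : choiceType) (A : set (set N)).

Definition Psi_nat (n : N) : Psi A := inl n.
Definition Psi_pt (a : A) : Psi A := inr a.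

Definition Psi_nbhs (x : Psi A) : set_system (Psi A) :=
  match x with
  | inl n => [set V | V (Psi_nat n)]
  | inr a => filter_from [set F : set N | finite_set F]
               (fun F => Psi_pt a |` Psi_nat @` (val a `\` F))
  end.

HB.instance Definition _ := Choice.on (Psi A).
HB.instance Definition _ := hasNbhs.Build (Psi A) Psi_nbhs.

Let Psi_nbhs_filter (x : Psi A) : ProperFilter (nbhs x).
Proof.
case: x => [n|a]; rewrite /nbhs /=.
  apply: Build_ProperFilter_ex; first by move=> V Vn; exists (Psi_nat n).
  by split=> //= P Q PQ; exact: PQ.
apply: filter_from_proper; last by move=> F _; exists (Psi_pt a); left.
apply: filter_from_filter; first by exists set0 => /=; exact: finite_set0.
move=> F G /= finF finG; exists (F `|` G); first by rewrite /= finite_setU.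
move=> _ [->|[n [an nFG] <-]]; first by split; left.
by split; right; exists n => //; split=> // ?; apply: nFG; [left|right].
Qed.

Let Psi_nbhs_singleton (x : Psi A) (V : set (Psi A)) : nbhs x V -> V x.
Proof. by case: x => [n //|a] [F _]; apply; left. Qed.

Let Psi_nbhs_nbhs (x : Psi A) (V : set (Psi A)) :
  nbhs x V -> nbhs x (nbhs^~ V).
Proof.
case: x => [n //|a] [F finF FV]; exists F => // _ [->|[n an <-]].
  by exists F.
by apply: FV; right; exists n.
Qed.

HB.instance Definition _ := Nbhs_isNbhsTopological.Build (Psi A)
  Psi_nbhs_filter Psi_nbhs_singleton Psi_nbhs_nbhs.

End PsiSpace.

Definition anti_Luzin (N : choiceType) (A : set (set N)) : Prop :=
  forall A0 A1 : set A, ~ countable A0 -> ~ countable A1 ->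
  exists B0 B1 : set A,
    [/\ B0 `<=` A0, B1 `<=` A1, ~ countable B0, ~ countable B1 &
        exists G0 G1 : set (Psi A),
          [/\ open G0, open G1, G0 `&` G1 = set0,
              @Psi_pt N A @` B0 `<=` G0 & @Psi_pt N A @` B1 `<=` G1]].

Section ProximalGame.
Context (Z : uniformType).

(* Finite sequences of legal moves of Player I, in chronological order. *)
Definition legal_history (s : seq (set (Z * Z))) : Prop :=
  (forall U, U \in s -> entourage U) /\
  sorted (fun U V : set (Z * Z) => `[< V `<=` U >]) s.

Definition legal_play (U : nat -> set (Z * Z)) : Prop :=
  (forall n, entourage (U n)) /\ (forall n, U n.+1 `<=` U n).

(* A strategy of Player II answers the nonempty history [U_0; ...; U_n] of
   moves of Player I with x_n; its value at the empty sequence is irrelevant. *)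
Definition strategyII (sigma : seq (set (Z * Z)) -> Z) : Prop :=
  forall s U V, legal_history (rcons (rcons s U) V) ->
    xsection U (sigma (rcons s U)) (sigma (rcons (rcons s U) V)).

Definition playerI_wins (U : nat -> set (Z * Z)) (x : nat -> Z) : Prop :=
  (exists l : Z, x n @[n --> \oo] --> l) \/
  \bigcap_n xsection (U n) (x n) = set0.

Definition winning_strategyII (sigma : seq (set (Z * Z)) -> Z) : Prop :=
  strategyII sigma /\
  forall U, legal_play U ->
    ~ playerI_wins U (fun n => sigma (mkseq U n.+1)).

Definition unif_semi_proximal : Prop :=
  ~ exists sigma, winning_strategyII sigma.

End ProximalGame.

(* [c] is a uniform-space structure on the carrier of [T]. *)
Definition semi_proximal (T : topologicalType) : Prop :=
  exists2 c : Uniform.axioms_ T,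
    @open (Uniform.Pack c) = @open T & unif_semi_proximal (Uniform.Pack c).

Definition ad_semi_proximal (N : choiceType) (A : set (set N)) : Prop :=
  semi_proximal (Psi A).

(* Main.v *)
Require Import Defs.
From mathcomp Require Import all_boot all_classical topology.

Local Open Scope classical_set_scope.

(** Suppose uncountable sets [A0] and [A1] of points of the Psi-space have no
    uncountable subsets separated by open sets. For a symmetric entourage [V],
    density of the countable set [N] gives a point [m] such that uncountably many
    points of [A1] are [V]-close to [m]; the points of [A0] that are not
    [V^3]-close to [m] could be separated from these, so there are only countably
    many of them. Hence, for every entourage [U], all but countably many points
    of [A0] are [U]-close to all but countably many points of [A0]. Player II can
    thus play points of [A0], no two consecutive ones equal, such that almost all
    points of [A0] stay in [U_n[x_n]] for all [n]; the sequence diverges because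
    [A0] is closed and discrete. *)

Section AlmostAll.
Context {T : Type}.
Implicit Types A B P Q : set T.

Lemma countable_subset {A B} : A `<=` B -> countable B -> countable A.
Proof. by move=> /subset_card_le; exact: sub_countable. Qed.

Lemma countable_setU A B : countable A -> countable B -> countable (A `|` B).
Proof.
by move=> cA cB; rewrite -bigcup2inE; apply: bigcup_countable => // -[|[|]].
Qed.

(** The co-countable filter on [A]. It is closed under countable intersections and, when [A] is
    uncountable, every member of it meets [A]. *)
Definition almost_all A P := countable (A `\` P).

Lemma almost_all_subset {A P Q} : P `<=` Q -> almost_all A P -> almost_all A Q.
Proof. by move=> PQ; apply: countable_subset => x [Ax nQ]; split=> // /PQ. Qed.

Lemma almost_allI {A P Q} :
  almost_all A P -> almost_all A Q -> almost_all A (P `&` Q).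
Proof. by rewrite /almost_all setDIr; exact: countable_setU. Qed.

Lemma almost_all_bigcap {A} {P : nat -> set T} :
  (forall n, almost_all A (P n)) -> almost_all A (\bigcap_n P n).
Proof.
move=> AP; apply: (@countable_subset _ (\bigcup_n (A `\` P n))).
  by move=> x [Ax] /existsNP[n] /not_implyP[_ nPx]; exists n.
by apply: bigcup_countable => [|n _]; [exact: countableP | exact: AP].
Qed.

Lemma almost_all_neq A (y : T) : almost_all A [set x | x <> y].
Proof.
by apply: (@countable_subset _ [set y]) => // x [_]; exact: contra_notP.
Qed.

Lemma almost_all_ex {A P} :
  ~ countable A -> almost_all A P -> exists2 x, A x & P x.
Proof.
move=> ncA AP; apply: contrapT => nex; apply: ncA.
by apply: countable_subset AP => x Ax; split=> // Px; apply: nex; exists x.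
Qed.

End AlmostAll.

Definition open_separated {T : topologicalType} (B0 B1 : set T) :=
  exists G0 G1 : set T,
    [/\ open G0, open G1, G0 `&` G1 = set0, B0 `<=` G0 & B1 `<=` G1].

Definition uncountably_separable {T : topologicalType} (A0 A1 : set T) :=
  exists B0 B1 : set T,
    [/\ B0 `<=` A0, B1 `<=` A1, ~ countable B0, ~ countable B1 &
        open_separated B0 B1].

Section Inseparable.
Context {Z : uniformType}.
Implicit Types (x y z : Z) (U V : set (Z * Z)).

Lemma symmetric_split {U} : entourage U ->
  exists V, [/\ entourage V, (forall x y, V (x, y) -> V (y, x)) &
                forall x y z, V (x, y) -> V (y, z) -> U (x, z)].
Proof.
move=> eU; have eW := entourage_split_ent eU.
exists (split_ent U `&` (split_ent U)^-1%relation); split.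
- by apply: filterI => //; exact: entourage_inv.
- by move=> x y [? ?]; split.
- by move=> x y z [Wxy _] [Wyz _]; exact: (entourage_split y).
Qed.

(** The interiors of the [V]-balls around the points of each set have open unions, and a point [z]
    common to both unions would be [V]-close to some [a] and some [b]. *)
Lemma separated_of_entourage {V} {B0 B1 : set Z} : entourage V ->
  (forall a b z, B0 a -> B1 b -> V (a, z) -> V (b, z) -> False) ->
  open_separated B0 B1.
Proof.
move=> eV sep.
have opn (B : set Z) : open (\bigcup_(a in B) (xsection V a)^°).
  by apply: bigcup_open => a _; exact: open_interior.
have sub (B : set Z) : B `<=` \bigcup_(a in B) (xsection V a)^°.
  by move=> a Ba; exists a => //; exact: (nbhs_entourage a eV).
exists (\bigcup_(a in B0) (xsection V a)^°).
exists (\bigcup_(a in B1) (xsection V a)^°).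
split=> //; rewrite -subset0 => z [[a B0a +] [b B1b +]].
move=> /interior_subset/xsectionP Vaz /interior_subset/xsectionP Vbz.
exact: (sep a b z).
Qed.

Context (D A0 A1 : set Z).
Hypotheses (cD : countable D) (denseD : dense D).
Hypotheses (ncA0 : ~ countable A0) (ncA1 : ~ countable A1).
Hypothesis (insep : ~ uncountably_separable A0 A1).

(** Every [V]-ball meets [D], so these sets, for [m] in [D], cover [A1]; countably many countable
    sets cannot do so. *)
Lemma uncountable_near_dense {V} : entourage V ->
  exists m, ~ countable (A1 `&` [set b | V (b, m)]).
Proof.
move=> eV; apply: contrapT => /forallNP cV; apply: ncA1.
apply: (@countable_subset _ _ (\bigcup_(m in D) (A1 `&` [set b | V (b, m)]))).
  move=> b A1b.
  have nb : (xsection V b)^° b := nbhs_entourage b eV.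
  have [|m [Vbm Dm]] := denseD _ (ex_intro _ b nb); first exact: open_interior.
  by exists m => //; split=> //=; apply/xsectionP; exact: interior_subset.
by apply: bigcup_countable => // m _; apply: contrapT; exact: cV.
Qed.

Lemma almost_all_close {U} : entourage U ->
  almost_all A0 [set x | almost_all A0 [set c | U (x, c)]].
Proof.
move=> /symmetric_split[V1 [eV1 symV1 V1U]].
have [V2 [eV2 _ V2V1]] := symmetric_split eV1.
have [V3 [eV3 symV3 V3V2]] := symmetric_split eV2.
have [m ncm] := uncountable_near_dense eV3.
have A0m : almost_all A0 [set a | V1 (m, a)].
  apply: contrapT => ncB; apply: insep.
  exists (A0 `\` [set a | V1 (m, a)]), (A1 `&` [set b | V3 (b, m)]).
  split; [by move=> ? []|by move=> ? []|by []|by []|].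
  apply: (separated_of_entourage eV3) => a b z [_ nV1] [_ /= /symV3 Vmb] Vaz Vbz.
  (* The [V3]-chain from [m] through [b] and [z] to [a] has three links; a trivial fourth link at
     [a] fits it to the two halvings from [V1] to [V3]. *)
  apply: nV1; apply: (V2V1 m z a); first exact: (V3V2 m b z).
  apply: (V3V2 z a a); first exact: symV3.
  exact: entourage_refl.
apply: (almost_all_subset _ A0m) => x V1mx.
by apply: (almost_all_subset _ A0m) => c V1mc; exact: (V1U x m c (symV1 _ _ V1mx)).
Qed.

(** All past moves are halved, not just the last one: the reply to a new move must still be close,
    up to half of the previous move, to the points that witness legality. *)
Fixpoint split_all (s : seq (set (Z * Z))) : set (Z * Z) :=
  if s is U :: s' then split_ent U `&` split_all s' else setT.

Lemma entourage_split_all {s} :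
  (forall U, U \in s -> entourage U) -> entourage (split_all s).
Proof.
elim: s => [_|U s IHs sE] /=; first exact: filterT.
apply: filterI; last by apply: IHs => V Vs; apply: sE; rewrite in_cons Vs orbT.
by apply: entourage_split_ent; apply: sE; rewrite mem_head.
Qed.

Let close V x := [set c | V (x, c) /\ V (c, x)].

Let good_reply y s :=
  [set x | [/\ A0 x, x <> y & almost_all A0 (close (split_all s) x)]].

(* The history is read most recent move first. *)
Fixpoint response (z0 : Z) (s : seq (set (Z * Z))) : Z :=
  if s is U :: s' then xget z0 (good_reply (response z0 s') s) else z0.

Lemma responseP z0 {U s} : (forall V, V \in U :: s -> entourage V) ->
  good_reply (response z0 s) (U :: s) (response z0 (U :: s)).
Proof.
move=> /entourage_split_all eW; apply: xgetPex.
(* Symmetrizing provides both directions required by [close]. *)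
have eWs : entourage (split_all (U :: s) `&` (split_all (U :: s))^-1%relation).
  by apply: filterI => //; exact: entourage_inv.
have [x A0x [xW neq]] := almost_all_ex ncA0
  (almost_allI (almost_all_close eWs) (almost_all_neq A0 (response z0 s))).
by exists x.
Qed.

Hypothesis discrA0 : forall l, nbhs l [set z | A0 z -> z = l].

Lemma inseparable_not_semi_proximal : ~ unif_semi_proximal Z.
Proof.
have [z0 _] := infinite_setN0 (contra_not (@finite_set_countable _ A0) ncA0).
apply; exists (fun s => response z0 (rev s)); split.
  move=> s U V [legal _]; rewrite !rev_rcons; apply/xsectionP.
  have eU : entourage U.
    by apply: legal; rewrite mem_rcons in_cons mem_rcons mem_head orbT.
  have [|_ _ aaU] := @responseP z0 U (rev s).
    move=> W; rewrite -rev_rcons mem_rev => Ws; apply: legal.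
    by rewrite mem_rcons in_cons Ws orbT.
  have [|_ _ aaV] := @responseP z0 V (U :: rev s).
    by move=> W; rewrite -!rev_rcons mem_rev; exact: legal.
  (* Consecutive replies are both close to almost all of [A0], hence to a common [c]. The two halves
     of [U], from the old reply to [c] and from [c] to the new one, compose to [U]. *)
  have [c _ [[[xc _] _] [_ [_ [cy _]]]]] :=
    almost_all_ex ncA0 (almost_allI aaU aaV).
  exact: (entourage_split c).
move=> U [eU _]; pose x n := response z0 (rev (mkseq U n.+1)).
have xE n : x n = response z0 (U n :: rev (mkseq U n)).
  by rewrite /x mkseqS rev_rcons.
have eUs n V : V \in U n :: rev (mkseq U n) -> entourage V.
  by rewrite -rev_rcons -mkseqS mem_rev => /mapP[k _ ->].
have A0x n : A0 (x n) by rewrite xE; case: (responseP z0 (eUs n)).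
have xneq n : x n.+1 <> x n by rewrite xE; case: (responseP z0 (eUs n.+1)).
case=> [[l xl]|].
  (* Near a limit [l] the only possible point of [A0] is [l], so a convergent play would be
     eventually constant. *)
  have [n _ nl] := xl _ (discrA0 l).
  have xnl k : n <= k -> x k = l by move=> nk; exact: nl k nk (A0x k).
  by apply: (xneq n); rewrite !xnl.
have xc n : almost_all A0 (xsection (U n) (x n)).
  rewrite xE; have [_ _] := responseP z0 (eUs n); apply: almost_all_subset => c.
  by move=> [[/(split_ent_subset (eU n)) Uc _] _]; apply/xsectionP.
have [c _ Uc] := almost_all_ex ncA0 (almost_all_bigcap xc).
by rewrite -subset0 => /(_ c); apply.
Qed.

End Inseparable.

Section PsiTopology.
Context {N : countType} (A : set (set N)).

Lemma Psi_nat_dense : (forall a, A a -> infinite_set a) ->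
  dense (range (@Psi_nat N A)).
Proof.
move=> infA G [[n|a] Gx] oG; first by exists (inl n); split=> //; exists n.
have [F finF FG] : nbhs (inr a : Psi A) G by exact: open_nbhs_nbhs.
have /infinite_setN0[n aFn] : infinite_set (val a `\` F).
  by apply: infinite_setD => //; apply: infA; exact: set_valP.
by exists (inl n); split; [apply: FG; right; exists n | exists n].
Qed.

Lemma Psi_pt_closed_discrete (l : Psi A) :
  nbhs l [set z | range (@Psi_pt N A) z -> z = l].
Proof.
case: l => [n|a]; first by move=> [].
exists set0; first exact: finite_set0.
by move=> z [->|[n _ <-] []].
Qed.

Lemma countable_Psi_pt (B : set A) : countable (@Psi_pt N A @` B) -> countable B.
Proof.
move=> /countable_injP[f finj]; apply/countable_injP.
exists (f \o @Psi_pt N A) => a b /set_mem Ba /set_mem Bb /= fab.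
have img e : B e -> Psi_pt e \in @Psi_pt N A @` B.
  by move=> Be; apply/mem_set; exists e.
by have [] := finj _ _ (img a Ba) (img b Bb) fab.
Qed.

Lemma anti_LuzinP : (forall A0 A1 : set A, ~ countable A0 -> ~ countable A1 ->
    uncountably_separable (@Psi_pt N A @` A0) (@Psi_pt N A @` A1)) ->
  anti_Luzin A.
Proof.
move=> sepA A0 A1 ncA0 ncA1.
have [B0 [B1 [sB0 sB1 ncB0 ncB1 [G0 [G1 [oG0 oG1 G01 BG0 BG1]]]]]] :=
  sepA A0 A1 ncA0 ncA1.
have pre (B : set (Psi A)) (C : set A) : B `<=` @Psi_pt N A @` C ->
    (@Psi_pt N A @^-1` B `<=` C) /\
    (~ countable B -> ~ countable (@Psi_pt N A @^-1` B)).
  (* [B] consists of points of the form [Psi_pt a], so it is covered by the image of its preimage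
     and is countable if the preimage is. *)
  move=> BC; split=> [a /BC[b Cb [<-]]//|]; apply: contra_not => cB.
  apply: (countable_subset _ (sub_countable (card_image_le (@Psi_pt N A) _) cB)).
  by move=> z Bz; have [a _ az] := BC z Bz; exists a; rewrite /= ?az.
have [? ?] := pre _ _ sB0; have [? ?] := pre _ _ sB1.
exists (@Psi_pt N A @^-1` B0), (@Psi_pt N A @^-1` B1); split; auto.
by exists G0, G1; split=> // _ [a Ba <-]; [exact: BG0 | exact: BG1].
Qed.

End PsiTopology.

Theorem proposition3 (N : countType) (A : set (set N)) :
  infinite_set [set: N] -> almost_disjoint A ->
  ad_semi_proximal A -> anti_Luzin A.
Proof.
move=> _ [infA _] [c openE spA]; apply: anti_LuzinP => A0 A1 ncA0 ncA1.
apply: contrapT => insep; move: spA.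
apply: (@inseparable_not_semi_proximal (Uniform.Pack c) (range (@Psi_nat N A))
  (@Psi_pt N A @` A0) (@Psi_pt N A @` A1)).
- exact: sub_countable (card_image_le _ _) (countableP _).
- by move: (Psi_nat_dense _ infA); rewrite /dense -openE.
- by move=> /countable_Psi_pt.
- by move=> /countable_Psi_pt.
- by move: insep; rewrite /uncountably_separable /open_separated -openE.
(* The uniform space and [Psi A] are only known to share their open sets, so neighbourhoods are
   unfolded to open sets before the transfer. *)
- move=> l; have := Psi_pt_closed_discrete A l.
  rewrite !nbhsE => -/=[O [oO Ol] OA]; exists O.
    by split=> //; rewrite openE.
  by move=> z Oz A0z; apply: (OA z Oz); case: A0z => a _ <-; exists a.
Qed.
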